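(* Let $H$ be a real inner product space with inner product $\langle\cdot,\cdot\rangle$ and associated norm $\|\cdot\|=\sqrt{\langle\cdot,\cdot\rangle}$. For all vectors $x,y,z\in H$ and all real numbers $\alpha,\beta,\gamma$, \[ \alpha^2\|x\|^2\langle y,z\rangle^2+\beta^2\|y\|^2\langle x,z\rangle^2+\gamma^2\|z\|^2\langle x,y\rangle^2+2(\alpha\beta+\alpha\gamma+\beta\gamma)\langle x,y\rangle\langle x,z\rangle\langle y,z\rangle\;\geq\;0. \] *)

(* Defs.v *)
From HB Require Import structures.
From mathcomp Require Import all_boot all_order all_algebra.
From mathcomp Require Import reals.
Set Implicit Arguments.
Unset Strict Implicit.
Unset Printing Implicit Defensive.

Import Order.TTheory GRing.Theory Num.Theory.
Local Open Scope ring_scope.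

(* A real inner product on H is a [{dot H for idfun}]: a bilinear, symmetric,
   positive definite form; no completeness or finite dimension is required. *)
Definition dotnorm (R : realType) (H : lmodType R) (dot : {dot H for idfun})
  (x : H) : R := Num.sqrt (dot x x).

(* Main.v *)
Require Import Defs.
From HB Require Import structures.
From mathcomp Require Import all_boot all_order all_algebra.
From mathcomp Require Import reals.
From mathcomp Require Import ring.

Set Implicit Arguments.
Unset Strict Implicit.
Unset Printing Implicit Defensive.

Import Order.TTheory GRing.Theory Num.Theory.
Local Open Scope ring_scope.

(** The left-hand side is a squared norm, namely that of the vector
    [(alpha * <y,z>) x + (beta * <x,z>) y + (gamma * <x,y>) z].  The diagonal
    terms of its expansion are the three squared terms of the inequality.
    Each cross term, for instance
    [2 <(alpha * <y,z>) x, (beta * <x,z>) y>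
     = 2 * alpha * beta * <x,y> * <x,z> * <y,z>],
    contains the same triple product of inner products, since its two
    coefficients supply the two inner products missing from [<x,y>]. *)

Section RealInnerProduct.
Variables (R : realType) (H : lmodType R) (dot : {dot H for idfun}).

Lemma dotC (u v : H) : dot u v = dot v u.
Proof. by rewrite hermC expr0 mul1r. Qed.

Lemma dot_ge0 (u : H) : 0 <= dot u u.
Proof.
by have [->|/neq0_dnorm_gt0/ltW ->//] := eqVneq u 0; rewrite linear0r.
Qed.

Lemma sqr_dotnorm (u : H) : dotnorm dot u ^+ 2 = dot u u.
Proof. by rewrite /dotnorm sqr_sqrtr ?dot_ge0. Qed.

Lemma dot_sum3 (a b c : R) (x y z : H) (w := a *: x + b *: y + c *: z) :
  dot w w = a ^+ 2 * dot x x + b ^+ 2 * dot y y + c ^+ 2 * dot z z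
    + 2 * (a * b * dot x y + a * c * dot x z + b * c * dot y z).
Proof.
rewrite /w !linearDl !linearDr !linearZl_LR !linearZr_LR /=.
rewrite (dotC y x) (dotC z x) (dotC z y).
ring.
Qed.

End RealInnerProduct.

Theorem theorem3p1 (R : realType) (H : lmodType R) (dot : {dot H for idfun})
    (x y z : H) (alpha beta gamma : R) :
  alpha ^+ 2 * dotnorm dot x ^+ 2 * dot y z ^+ 2
  + beta ^+ 2 * dotnorm dot y ^+ 2 * dot x z ^+ 2
  + gamma ^+ 2 * dotnorm dot z ^+ 2 * dot x y ^+ 2
  + 2 * (alpha * beta + alpha * gamma + beta * gamma)
      * dot x y * dot x z * dot y z >= 0.
Proof.
have := dot_ge0 dot ((alpha * dot y z) *: x + (beta * dot x z) *: y
                     + (gamma * dot x y) *: z).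
rewrite dot_sum3 !sqr_dotnorm.
by congr (_ <= _); ring.
Qed.
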